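(* Let $k=2m+1$ and $l=2n+1$ be odd integers, and let $\pi_1(k,l)=\langle a,b \mid a w_k^n b = w_k^{n+1}\rangle$ with $w_k=(ab^{-1})^m ab (a^{-1}b)^m$ be the link group of the double twist link $J(k,l)$. For a representation $\rho:\pi_1(k,l)\to \mathrm{SL}_2(\mathbb C)$ put $x=\operatorname{tr}\rho(a)$, $y=\operatorname{tr}\rho(b)$, $z=\operatorname{tr}\rho(ab^{-1})$. Then: (1) The vanishing set of $xyz+4-x^2-y^2-z^2$ in $\mathbb C^3(x,y,z)$ is the set of characters of reducible representations $\pi_1(k,l)\to\mathrm{SL}_2(\mathbb C)$. (2) A natural model for the algebraic set $X_{irr}(k,l)$ is the vanishing set in $\mathbb C^3(x,y,z)$ of \[ S_n(t)S_{m-1}(z)-S_{n-1}(t)S_m(z),\] where \[t=\left( xS_m(z)-yS_{m-1}(z) \right)\left( yS_m(z)-xS_{m-1}(z) \right)-z\left(S^2_m(z)+S^2_{m-1}(z)\right)+4S_m(z)S_{m-1}(z).\]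
   Context: $J(k,l)$ is the two-bridge link with continued fraction $[k,-l]$ (the double twist link with $k$ and $l$ half twists in its two twist boxes); for $k,l$ both odd it has two components. The $\mathrm{SL}_2(\mathbb C)$ character variety $X(k,l)$ is the set of characters $\chi_\rho(\gamma)=\operatorname{tr}\rho(\gamma)$ of representations $\rho:\pi_1(k,l)\to\mathrm{SL}_2(\mathbb C)$; via $\chi\mapsto(\chi(a),\chi(b),\chi(ab^{-1}))$ it is identified with an algebraic subset of $\mathbb C^3(x,y,z)$. $X_{irr}(k,l)$ denotes the closure of the set of characters of irreducible representations. The Chebyshev polynomials $S_j(\omega)$ are defined for all integers $j$ by $S_0=1$, $S_1=\omega$, $S_{j+1}(\omega)=\omega S_j(\omega)-S_{j-1}(\omega)$. *)

(* Defs.v *)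
From HB Require Import structures.
From mathcomp Require Import all_boot all_order all_algebra.
From mathcomp Require Import mpoly.
Set Implicit Arguments. Unset Strict Implicit. Unset Printing Implicit Defensive.
Import Order.TTheory GRing.Theory Num.Theory.
Local Open Scope ring_scope.

Fixpoint chebN (R : ringType) (j : nat) (w : R) : R :=
  match j with
  | 0%N => 1
  | S p => match p with
           | 0%N => w
           | S q => w * chebN p w - chebN q w
           end
  end.

(* Extension to all integers by the same recursion:
   S_{-1} = 0 and S_{-(j+2)} = - S_j (Negz j denotes -(j+1)). *)
Definition cheb (R : ringType) (j : int) (w : R) : R :=
  match j with
  | Posz k => chebN k w
  | Negz 0 => 0
  | Negz (S k) => - chebN k w
  end.

Definition wordW (C : fieldType) (m : int) (A B : 'M[C]_2) : 'M[C]_2 :=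
  (A * B^-1) ^ m * (A * B) * (A^-1 * B) ^ m.

(* A pair (A,B) = (rho(a), rho(b)) defines a representation
   pi_1(k,l) = < a, b | a w^n b = w^(n+1) > -> SL_2(C). *)
Definition is_rep (C : fieldType) (m n : int) (A B : 'M[C]_2) : Prop :=
  \det A = 1 /\ \det B = 1 /\
  A * (wordW m A B) ^ n * B = (wordW m A B) ^ (n + 1).

Definition reducible (C : fieldType) (A B : 'M[C]_2) : Prop :=
  exists v : 'cV[C]_2, v != 0 /\
    exists a b : C, A *m v = a *: v /\ B *m v = b *: v.

Definition charpt (C : fieldType) (A B : 'M[C]_2) : C * C * C :=
  (\tr A, \tr B, \tr (A * B^-1)).

Definition red_chars (C : fieldType) (m n : int) (p : C * C * C) : Prop :=
  exists A B : 'M[C]_2, is_rep m n A B /\ reducible A B /\ charpt A B = p.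

Definition irr_chars (C : fieldType) (m n : int) (p : C * C * C) : Prop :=
  exists A B : 'M[C]_2, is_rep m n A B /\ ~ reducible A B /\ charpt A B = p.

Definition pt3 (C : ringType) (p : C * C * C) : 'I_3 -> C :=
  fun i => match val i with 0%N => p.1.1 | 1%N => p.1.2 | _ => p.2 end.

Definition zariski_closure (C : comRingType) (S : C * C * C -> Prop)
    (p : C * C * C) : Prop :=
  forall f : {mpoly C[3]},
    (forall q, S q -> f.@[pt3 q] = 0) -> f.@[pt3 p] = 0.

Definition X_irr (C : fieldType) (m n : int) (p : C * C * C) : Prop :=
  zariski_closure (irr_chars m n) p.

Definition tvar (C : ringType) (m : int) (x y z : C) : C :=
  (x * cheb m z - y * cheb (m - 1) z) * (y * cheb m z - x * cheb (m - 1) z)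
  - z * (cheb m z ^+ 2 + cheb (m - 1) z ^+ 2)
  + 4 * cheb m z * cheb (m - 1) z.

Definition Pirr (C : ringType) (m n : int) (x y z : C) : C :=
  let t := tvar m x y z in
  cheb n t * cheb (m - 1) z - cheb (n - 1) t * cheb m z.

(* Main.v *)
Require Import Defs.
From HB Require Import structures.
From mathcomp Require Import all_boot all_order all_algebra.
From mathcomp Require Import mpoly.
From mathcomp Require Import ring zify.
Import GRing.Theory Num.Theory.
Set Implicit Arguments. Unset Strict Implicit.
Local Open Scope ring_scope.

(* For A, B in SL_2 put U = A B^-1.  By Cayley-Hamilton every power of a
   matrix of determinant 1 is an affine combination X^k = S_(k-1) X - S_(k-2)
   of itself and the identity.  Since w_k = U^m A U^-m B, a 2x2 computation
   gives tr w_k = t and A w_k^n B - w_k^(n+1) = P(x, y, z) [A, U] Q with Q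
   invertible, where P is the polynomial of part (2).  Hence (A, B) is a
   representation iff P vanishes at its character or A and B commute, and
   commuting pairs are reducible.  The commutator of a reducible pair has the
   eigenvalue 1, so the Fricke polynomial 2 - tr [A, B] vanishes at its
   character; conversely each zero of it is the character of a diagonal pair,
   and every point of C^3 is the character of some pair.  Finally P
   depends on (x, y) only through the product l1 l2 of two linear forms, so
   each zero of P lies on a line or hyperbola inside V(P) that meets the Fricke
   surface in finitely many points; a polynomial vanishing on the irreducible
   characters therefore vanishes on all of V(P). *)

Lemma int_ind_succ (P : int -> Prop) :
  P 0 -> (forall k, P k -> P (k + 1)) -> (forall k, P (k + 1) -> P k) ->
  forall k, P k.
Proof.
move=> P0 Psucc Ppred [j|j].
  elim: j => // j IHj; rewrite -addn1 PoszD; exact: Psucc.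
elim: j => [|j IHj]; first exact: Ppred.
by apply: Ppred; rewrite !NegzE; have -> : - (j.+2)%:Z + 1 = - (j.+1)%:Z by lia.
Qed.

Lemma chebN_SS (R : nzRingType) j (w : R) :
  chebN j.+2 w = w * chebN j.+1 w - chebN j w.
Proof. by []. Qed.

Section Chebyshev.
Variable R : comNzRingType.
Implicit Types (k : int) (w : R).

Lemma chebS k w : cheb (k + 1) w = w * cheb k w - cheb (k - 1) w.
Proof.
case: k => [[|j]|[|[|j]]]; first by rewrite /= mulr1 subr0.
- have -> : Posz j.+1 + 1 = Posz j.+2 by rewrite -PoszD addn1.
  by have -> : Posz j.+1 - 1 = Posz j by lia.
- by rewrite /= mulr0 sub0r opprK.
- by rewrite /= mulrN mulr1 subrr.
- have -> : Negz j.+2 + 1 = Negz j.+1 by rewrite !NegzE; lia.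
  have -> : Negz j.+2 - 1 = Negz j.+3 by rewrite !NegzE; lia.
  by rewrite /=; ring.
Qed.

Lemma cheb_rec k w : cheb k w = w * cheb (k - 1) w - cheb (k - 2) w.
Proof.
have -> : k - 2 = k - 1 - 1 by lia.
by rewrite -chebS; have -> : k - 1 + 1 = k by lia.
Qed.

Lemma cheb_cassini k w :
  cheb k w ^+ 2 - w * cheb k w * cheb (k - 1) w + cheb (k - 1) w ^+ 2 = 1.
Proof.
elim/int_ind_succ: k => [|k IHk|k]; first by rewrite /=; ring.
- by rewrite chebS addrK -{}IHk; ring.
- by rewrite chebS addrK => <-; ring.
Qed.

End Chebyshev.

Section ChebyshevMorphism.
Variables (R S : comNzRingType) (f : {rmorphism R -> S}).

Lemma chebN_rmorph j w : f (chebN j w) = chebN j (f w).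
Proof.
suff [] : f (chebN j w) = chebN j (f w) /\ f (chebN j.+1 w) = chebN j.+1 (f w).
  by [].
elim: j => [|j [IHj IHj1]]; first by rewrite /= rmorph1.
by split=> //; rewrite !chebN_SS rmorphB rmorphM IHj IHj1.
Qed.

Lemma cheb_rmorph k w : f (cheb k w) = cheb k (f w).
Proof.
by case: k => [j|[|j]] /=; rewrite ?rmorph0 ?rmorphN ?chebN_rmorph.
Qed.

Lemma Pirr_rmorph m n x y z : f (Pirr m n x y z) = Pirr m n (f x) (f y) (f z).
Proof.
rewrite /Pirr /tvar.
by rewrite !(rmorphB, rmorphM, rmorphD, cheb_rmorph, rmorphXn, rmorph_nat, rmorph1).
Qed.

End ChebyshevMorphism.

Section TwoByTwo.
Variable R : comNzRingType.
Implicit Types (a b c d k : R) (M : 'M[R]_2).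

Definition mx2 a b c d : 'M[R]_2 :=
  \matrix_(i, j) if i == 0 :> nat then (if j == 0 :> nat then a else b)
                 else (if j == 0 :> nat then c else d).

Lemma ord2P (i : 'I_2) : i = ord0 \/ i = ord_max.
Proof. by case: i => [[|[|k]] lti]; [left|right|] => //; apply: val_inj. Qed.

Lemma sum_ord2 (F : 'I_2 -> R) : \sum_i F i = F ord0 + F ord_max.
Proof. by rewrite big_ord_recl big_ord1; congr (_ + F _); apply/val_inj. Qed.

Lemma mx2E M :
  M = mx2 (M ord0 ord0) (M ord0 ord_max) (M ord_max ord0) (M ord_max ord_max).
Proof.
by apply/matrixP=> i j; rewrite mxE; case: (ord2P i) => ->; case: (ord2P j) => ->.
Qed.

Lemma mx2_congr a b c d a' b' c' d' :
  a = a' -> b = b' -> c = c' -> d = d' -> mx2 a b c d = mx2 a' b' c' d'.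
Proof. by move=> -> -> -> ->. Qed.

Ltac entrywise := let i := fresh "i" in let j := fresh "j" in
  apply/matrixP=> i j; rewrite ?mxE /=;
  by case: (ord2P i) => ->; case: (ord2P j) => ->.

Lemma mx2M a b c d a' b' c' d' :
  mx2 a b c d * mx2 a' b' c' d' =
  mx2 (a * a' + b * c') (a * b' + b * d') (c * a' + d * c') (c * b' + d * d').
Proof.
apply/matrixP=> i j; rewrite -mulmxE !mxE sum_ord2 !mxE.
by case: (ord2P i) => ->; case: (ord2P j) => ->.
Qed.

Lemma mx2D a b c d a' b' c' d' :
  mx2 a b c d + mx2 a' b' c' d' = mx2 (a + a') (b + b') (c + c') (d + d').
Proof. entrywise. Qed.

Lemma mx2N a b c d : - mx2 a b c d = mx2 (- a) (- b) (- c) (- d).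
Proof. entrywise. Qed.

Lemma mx2B a b c d a' b' c' d' :
  mx2 a b c d - mx2 a' b' c' d' = mx2 (a - a') (b - b') (c - c') (d - d').
Proof. by rewrite mx2N mx2D. Qed.

Lemma mx2Z k a b c d : k *: mx2 a b c d = mx2 (k * a) (k * b) (k * c) (k * d).
Proof. entrywise. Qed.

Lemma mx2_scalar k : k%:M = mx2 k 0 0 k.
Proof. entrywise. Qed.

Lemma mx2_1 : 1 = mx2 1 0 0 1.
Proof. exact: mx2_scalar. Qed.

Lemma mx2_trace a b c d : \tr (mx2 a b c d) = a + d.
Proof. by rewrite /mxtrace sum_ord2 !mxE. Qed.

Lemma mx2_det a b c d : \det (mx2 a b c d) = a * d - b * c.
Proof.
rewrite (expand_det_row _ ord0) sum_ord2 /cofactor !det_mx11 !mxE /=.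
by rewrite !expr0 !expr1 /=; ring.
Qed.

(* For 2x2 matrices this is the adjugate, [\adj M]. *)
Definition adj2 M := (\tr M)%:M - M.

Lemma adj2_mx2 a b c d : adj2 (mx2 a b c d) = mx2 d (- b) (- c) a.
Proof. by rewrite /adj2 mx2_trace mx2_scalar mx2B; apply: mx2_congr; ring. Qed.

End TwoByTwo.

Ltac mx2_simpl :=
  rewrite ?(mx2M, mx2D, mx2B, mx2Z, mx2_scalar, mx2N, adj2_mx2, mx2_trace, mx2_det).

Definition bracket (R : nzRingType) (x y : R) := x * y - y * x.

Section Adjugate2.
Variable R : comNzRingType.
Implicit Types (a b : R) (A B K M U : 'M[R]_2).

Lemma mul_adj2 M : M * adj2 M = (\det M)%:M.
Proof. by rewrite [M]mx2E; do 2 mx2_simpl; apply: mx2_congr; ring. Qed.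

Lemma adj2_mul M : adj2 M * M = (\det M)%:M.
Proof. by rewrite [M]mx2E; do 2 mx2_simpl; apply: mx2_congr; ring. Qed.

Lemma mx2_cayley_hamilton M : M * M = \tr M *: M - (\det M)%:M.
Proof. by rewrite [M]mx2E; do 2 mx2_simpl; apply: mx2_congr; ring. Qed.

Lemma det_adj2 M : \det (adj2 M) = \det M.
Proof. by rewrite [M]mx2E; do 2 mx2_simpl; ring. Qed.

Lemma det_affine2 U a b :
  \det (a *: U - b%:M) = a ^+ 2 * \det U - a * b * \tr U + b ^+ 2.
Proof. by rewrite [U]mx2E; do 3 mx2_simpl; ring. Qed.

Lemma det_subr1 K : \det (K - 1) = \det K - \tr K + 1.
Proof. by rewrite [K]mx2E mx2_1; do 2 mx2_simpl; ring. Qed.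

Lemma trace_commutator2 A B :
  \tr (A * adj2 B * adj2 A * B) = \det B * \tr A ^+ 2 + \det A * \tr B ^+ 2
    + \tr (A * adj2 B) ^+ 2 - \tr A * \tr B * \tr (A * adj2 B) - 2 * \det A * \det B.
Proof. by rewrite [A]mx2E [B]mx2E; do 4 mx2_simpl; ring. Qed.

Lemma trace_conj_word A B a b :
  let U := A * adj2 B in let P := a *: U - b%:M in
  let x := \tr A in let y := \tr B in let z := \tr U in
  let dA := \det A in let dB := \det B in let S := a * z - b in
  \tr (P * A * adj2 P * B) =
    x * y * S ^+ 2 - dB * x ^+ 2 * S * a - dA * y ^+ 2 * S * a
    + dA * dB * x * y * a ^+ 2 - z * S ^+ 2 - dA * dB * z * a ^+ 2
    + 4 * dA * dB * S * a.
Proof. by rewrite /= [A]mx2E [B]mx2E; do 5 mx2_simpl; ring. Qed.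

Lemma bracket_conj_word A B a b :
  let U := A * adj2 B in let P := a *: U - b%:M in
  let W := P * A * adj2 P * B in
  bracket A (W * P) = (\tr W * a - \det P * (a * \tr U - b)) *: bracket A U.
Proof. by rewrite /= /bracket [A]mx2E [B]mx2E; do 7 mx2_simpl; apply: mx2_congr; ring. Qed.

End Adjugate2.

Lemma exprz_conj (R : unitRingType) (Q X : R) (k : int) :
  Q \is a GRing.unit -> X \is a GRing.unit ->
  (Q^-1 * X * Q) ^ k = Q^-1 * X ^ k * Q.
Proof.
move=> uQ uX; have conj_exp j : (Q^-1 * X * Q) ^+ j = Q^-1 * X ^+ j * Q.
  elim: j => [|j IHj]; first by rewrite !expr0 mulr1 mulVr.
  by rewrite !exprSr IHj !mulrA mulrK.
case: k => j; first exact: conj_exp.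
by rewrite /exprz conj_exp !invrM ?(unitrMr, unitrV, unitrX) // invrK mulrA.
Qed.

Lemma relator_bracket (R : nzRingType) (A B P Pi Y : R) : P * Pi = 1 ->
  A * Y * B - Y * (P * A * Pi * B) = bracket A (Y * P) * Pi * B.
Proof.
by move=> PPi; rewrite /bracket !mulrBl !mulrA -(mulrA (A * Y)) PPi mulr1.
Qed.

Section BracketAlgebra.
Variables (R : comNzRingType) (V : algType R).
Implicit Types (x y : V) (c d : R).

Lemma bracket_affine x y c d : bracket x (c *: y - d%:A) = c *: bracket x y.
Proof.
rewrite /bracket mulrBr mulrBl mulr_algr mulr_algl -scalerAr -scalerAl.
by rewrite opprB addrA subrK scalerBr.
Qed.

Lemma bracket_affine_mull x y z c d :
  bracket x ((c *: y - d%:A) * z) = c *: bracket x (y * z) - d *: bracket x z.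
Proof.
rewrite /bracket mulrBl mulr_algl -scalerAl !mulrBr !mulrBl -!scalerAr -!scalerAl.
by rewrite !scalerBr !opprD !opprK addrACA.
Qed.

End BracketAlgebra.

Section SL2.
Variable R : comUnitRingType.
Implicit Types X : 'M[R]_2.

Lemma unitmx_det1 X : \det X = 1 -> X \is a GRing.unit.
Proof. by move=> dX; rewrite unitmxE dX unitr1. Qed.

Lemma invmx_det1 X : \det X = 1 -> X^-1 = adj2 X.
Proof.
move=> dX; rewrite -[adj2 X]mul1r -(mulVr (unitmx_det1 dX)) -mulrA mul_adj2 dX.
by rewrite mulr1.
Qed.

Lemma exprz_cheb2 X (k : int) : \det X = 1 ->
  X ^ k = cheb (k - 1) (\tr X) *: X - (cheb (k - 2) (\tr X))%:M.
Proof.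
move=> dX; have uX := unitmx_det1 dX.
have CH : X * X = \tr X *: X - 1%:M by rewrite mx2_cayley_hamilton dX.
elim/int_ind_succ: k => [|k IHk|k IHk].
- by rewrite expr0z scale0r sub0r /= mx2_scalar mx2_1 mx2N opprK oppr0.
- rewrite exprzDr // IHk expr1z mulrBl -scalerAl CH.
  have -> : k + 1 - 1 = k - 1 + 1 by lia.
  have -> : k + 1 - 2 = k - 1 by lia.
  rewrite chebS; have -> : k - 1 - 1 = k - 2 by lia.
  by move: (\tr X) => w; rewrite [X]mx2E; do 4 mx2_simpl; apply: mx2_congr; ring.
- have -> : X ^ k = X^-1 * X ^ (k + 1).
    by rewrite addrC exprzDr // expr1z mulrA mulVr // mul1r.
  rewrite IHk invmx_det1 // /adj2 mulrBr mulrBl -!scalerAr CH.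
  have -> : k + 1 - 1 = k - 1 + 1 by lia.
  have -> : k + 1 - 2 = k - 1 by lia.
  rewrite chebS; have -> : k - 1 - 1 = k - 2 by lia.
  by move: (\tr X) => w; rewrite [X]mx2E; do 4 mx2_simpl; apply: mx2_congr; ring.
Qed.

End SL2.

Lemma wordW_conj (C : fieldType) (m : int) (A B : 'M[C]_2) :
  A \is a GRing.unit -> B \is a GRing.unit ->
  wordW m A B = (A * B^-1) ^ m * A * ((A * B^-1) ^ m)^-1 * B.
Proof.
rewrite /wordW => uA uB; have uU : A * B^-1 \is a GRing.unit by rewrite unitrMr ?unitrV.
have -> : A^-1 * B = B^-1 * (A * B^-1)^-1 * B.
  by rewrite invrM ?unitrV // invrK !mulrA mulVr // mul1r.
rewrite exprz_conj ?unitrV // exprz_inv -invr_expz.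
by rewrite !mulrA mulrK.
Qed.

Section Relator.
Variables (C : fieldType) (m n : int) (A B : 'M[C]_2).
Hypotheses (dA : \det A = 1) (dB : \det B = 1).

(* The power [(A * B^-1) ^ m], in the form given by [exprz_cheb2] and
   [B^-1 = adj2 B]. *)
Definition powU : 'M[C]_2 :=
  cheb (m - 1) (\tr (A * adj2 B)) *: (A * adj2 B) - (cheb (m - 2) (\tr (A * adj2 B)))%:M.

Lemma det_powU : \det powU = 1.
Proof.
have dU : \det (A * adj2 B) = 1 by rewrite detM det_adj2 dA dB mulr1.
rewrite det_affine2 dU mulr1 -[RHS](cheb_cassini (m - 1) (\tr (A * adj2 B))).
have -> : m - 1 - 1 = m - 2 by lia.
ring.
Qed.

Lemma bracket_powU :
  bracket A powU = cheb (m - 1) (\tr (A * adj2 B)) *: bracket A (A * adj2 B).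
Proof. by rewrite /powU -scalemx1 bracket_affine. Qed.

Lemma wordW_powU : wordW m A B = powU * A * adj2 powU * B.
Proof.
rewrite wordW_conj ?unitmx_det1 // exprz_cheb2; last by rewrite detM detV dA dB invr1 mulr1.
by rewrite [B^-1]invmx_det1 // -/powU invmx_det1 ?det_powU.
Qed.

Lemma trace_wordW :
  \tr (wordW m A B) = tvar m (\tr A) (\tr B) (\tr (A * B^-1)).
Proof.
rewrite wordW_powU /powU invmx_det1 //.
by rewrite trace_conj_word dA dB /tvar (cheb_rec m); ring.
Qed.

Lemma relator_factor : exists2 Q : 'M[C]_2, Q \is a GRing.unit &
  A * wordW m A B ^ n * B - wordW m A B ^ (n + 1) =
  Pirr m n (\tr A) (\tr B) (\tr (A * B^-1)) *: (bracket A (A * B^-1) * Q).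
Proof.
have dP := det_powU; have tW := trace_wordW.
rewrite invmx_det1 // in tW *.
have dW : \det (wordW m A B) = 1.
  by rewrite wordW_powU !detM det_adj2 dP dA dB !mulr1.
exists (adj2 powU * B); first by rewrite unitmx_det1 // detM det_adj2 dP dB mulr1.
rewrite exprzDr ?unitmx_det1 // expr1z {3}wordW_powU relator_bracket; last first.
  by rewrite mul_adj2 dP.
rewrite (exprz_cheb2 n dW) -scalemx1 bracket_affine_mull.
rewrite {2}wordW_powU /powU bracket_conj_word -/powU -wordW_powU.
rewrite bracket_powU dP mul1r tW !scalerA -scalerBl -!scalerAl -mulrA.
by congr (_ *: _); rewrite /Pirr (cheb_rec n) (cheb_rec m); ring.
Qed.

End Relator.

Lemma bracket_mulV_eq0 (R : unitRingType) (A B : R) :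
  A \is a GRing.unit -> B \is a GRing.unit ->
  bracket A (A / B) = 0 <-> A * B = B * A.
Proof.
move=> uA uB; rewrite /bracket; split=> [/eqP|AB].
  rewrite subr_eq0 -mulrA => /eqP/(mulrI uA) ABV.
  have := congr1 (fun M => B * M * B) ABV.
  by rewrite /= !mulrA divrK // mulrV // mul1r => ->.
by rewrite {1}(commrV AB) mulrA subrr.
Qed.

Lemma is_rep_iff (C : fieldType) (m n : int) (A B : 'M[C]_2) :
  \det A = 1 -> \det B = 1 ->
  is_rep m n A B <-> Pirr m n (\tr A) (\tr B) (\tr (A / B)) = 0 \/ A * B = B * A.
Proof.
move=> dA dB; have [uA uB] := (unitmx_det1 dA, unitmx_det1 dB).
have [Q uQ relE] := relator_factor m n dA dB.
rewrite /is_rep -(bracket_mulV_eq0 uA uB); split.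
- case=> _ [_ /eqP]; rewrite -subr_eq0 relE scaler_eq0 => /orP[/eqP|/eqP]; first by left.
  by move/(canRL (mulrK uQ)); rewrite mul0r; right.
- move=> H; do 2 split=> //; apply/eqP; rewrite -subr_eq0 relE.
  by case: H => ->; rewrite ?scale0r ?mul0r ?scaler0.
Qed.

Section Vectors2.
Variable R : comNzRingType.

Definition cv2 (a b : R) : 'cV[R]_2 := \col_i (if i == 0 :> nat then a else b).

Lemma cv2E (v : 'cV[R]_2) : v = cv2 (v ord0 0) (v ord_max 0).
Proof. by apply/matrixP=> i j; rewrite mxE (ord1 j); case: (ord2P i) => ->. Qed.

Lemma mx2_mulcv a b c d v0 v1 :
  mx2 a b c d *m cv2 v0 v1 = cv2 (a * v0 + b * v1) (c * v0 + d * v1).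
Proof.
by apply/matrixP=> i j; rewrite !mxE sum_ord2 !mxE; case: (ord2P i) => ->.
Qed.

Lemma cv2Z k a b : k *: cv2 a b = cv2 (k * a) (k * b).
Proof. by apply/matrixP=> i j; rewrite !mxE; case: (ord2P i) => ->. Qed.

Lemma cv2_inj a b a' b' : cv2 a b = cv2 a' b' -> a = a' /\ b = b'.
Proof.
by move=> /matrixP E; have := E ord0 0; have := E ord_max 0; rewrite !mxE /= => -> ->.
Qed.

Lemma cv2_neq0 a b : (a != 0) || (b != 0) -> cv2 a b != 0.
Proof.
apply: contraTN => /eqP/matrixP E; have := E ord0 0; have := E ord_max 0.
by rewrite !mxE /= => -> ->; rewrite eqxx.
Qed.

End Vectors2.

Lemma eq_by_multiple (R : comNzRingType) (a b k e : R) : e = 0 -> a - b = k * e -> a = b.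
Proof. by move=> -> /eqP; rewrite mulr0 subr_eq0 => /eqP. Qed.

Section Eigenlines.
Variable C : numClosedFieldType.
Implicit Types (p q r s l : C) (A B : 'M[C]_2) (v w : 'cV[C]_2).

Lemma exists_quadratic_root p q : exists l, l ^+ 2 - p * l + q = 0.
Proof.
exists ((p + sqrtC (p ^+ 2 - 4 * q)) / 2).
have := sqrtCK (p ^+ 2 - 4 * q); move: (sqrtC _) => d d2.
have e0 : d ^+ 2 - (p ^+ 2 - 4 * q) = 0 by rewrite d2 subrr.
by apply: (eq_by_multiple (k := 4^-1) e0); rewrite subr0; field.
Qed.

Definition eigenline A v l :=
  A *m v = l *: v /\ forall w, A *m w = l *: w -> exists mu, w = mu *: v.

Lemma eigenline_upper p q r s l : q != 0 ->
  l ^+ 2 - (p + s) * l + (p * s - q * r) = 0 ->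
  eigenline (mx2 p q r s) (cv2 q (l - p)) l.
Proof.
move=> q0 hl; split.
  by rewrite mx2_mulcv cv2Z; congr cv2; [ring | apply: (eq_by_multiple (k := -1) hl); ring].
move=> w; rewrite [w]cv2E mx2_mulcv cv2Z => /cv2_inj [e0 _].
exists (w ord0 0 / q); rewrite cv2Z; congr cv2; first by rewrite divfK.
have e : p * w ord0 0 + q * w ord_max 0 - l * w ord0 0 = 0 by rewrite e0 subrr.
by apply: (eq_by_multiple (k := q^-1) e); field.
Qed.

Lemma eigenline_lower p q r s l : r != 0 ->
  l ^+ 2 - (p + s) * l + (p * s - q * r) = 0 ->
  eigenline (mx2 p q r s) (cv2 (l - s) r) l.
Proof.
move=> r0 hl; split.
  by rewrite mx2_mulcv cv2Z; congr cv2; [apply: (eq_by_multiple (k := -1) hl) | ]; ring.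
move=> w; rewrite [w]cv2E mx2_mulcv cv2Z => /cv2_inj [_ e0].
exists (w ord_max 0 / r); rewrite cv2Z; congr cv2; last by rewrite divfK.
have e : r * w ord0 0 + s * w ord_max 0 - l * w ord_max 0 = 0 by rewrite e0 subrr.
by apply: (eq_by_multiple (k := r^-1) e); field.
Qed.

Lemma eigenline_diag p s : p != s -> eigenline (mx2 p 0 0 s) (cv2 1 0) p.
Proof.
move=> ps; split; first by rewrite mx2_mulcv cv2Z; congr cv2; ring.
move=> w; rewrite [w]cv2E mx2_mulcv cv2Z => /cv2_inj [_].
rewrite !mul0r !add0r => /eqP; rewrite -subr_eq0 -mulrBl mulf_eq0 subr_eq0.
rewrite eq_sym (negbTE ps) /= => /eqP ->.
by exists (w ord0 0); rewrite cv2Z mulr1 mulr0.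
Qed.

Lemma mx2_eigenline_or_scalar A :
  (exists v l, v != 0 /\ eigenline A v l) \/ exists l, A = l%:M.
Proof.
rewrite [A]mx2E.
move: (A ord0 ord0) (A ord0 ord_max) (A ord_max ord0) (A ord_max ord_max) => p q r s.
have [l hl] := exists_quadratic_root (p + s) (p * s - q * r).
have [q0|q0] := eqVneq q 0; last first.
  left; exists (cv2 q (l - p)), l.
  by split; [apply: cv2_neq0; rewrite q0 | exact: eigenline_upper].
have [r0|r0] := eqVneq r 0; last first.
  left; exists (cv2 (l - s) r), l.
  by split; [apply: cv2_neq0; rewrite r0 orbT | exact: eigenline_lower].
have [<-|ps] := eqVneq p s; first by right; exists p; rewrite q0 r0 mx2_scalar.
left; exists (cv2 1 0), p; rewrite q0 r0.
by split; [apply: cv2_neq0; rewrite oner_eq0 | exact: eigenline_diag].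
Qed.

Lemma commute_reducible A B : A * B = B * A -> reducible A B.
Proof.
move=> AB; have [[v [l [v0 [Av lineA]]]] | [l ->]] := mx2_eigenline_or_scalar A.
  have [mu Bv] : exists mu, B *m v = mu *: v.
    by apply: lineA; rewrite mulmxA mulmxE AB -mulmxE -mulmxA Av scalemxAr.
  by exists v; split=> //; exists l, mu.
have [[v [l' [v0 [Bv _]]]] | [l' ->]] := mx2_eigenline_or_scalar B.
  by exists v; split=> //; exists l, l'; rewrite mul_scalar_mx.
exists (cv2 1 0); split; first by apply: cv2_neq0; rewrite oner_eq0.
by exists l, l'; rewrite !mul_scalar_mx.
Qed.

End Eigenlines.

Definition fricke (R : comNzRingType) (x y z : R) :=
  x * y * z + 4 - x ^+ 2 - y ^+ 2 - z ^+ 2.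

Lemma trace_commutator_fricke (R : comNzRingType) (A B : 'M[R]_2) :
  \det A = 1 -> \det B = 1 ->
  \tr (A * adj2 B * adj2 A * B) = 2 - fricke (\tr A) (\tr B) (\tr (A * adj2 B)).
Proof. by move=> dA dB; rewrite trace_commutator2 dA dB /fricke; ring. Qed.

Section ReducibleFricke.
Variable C : fieldType.
Implicit Types (A B X : 'M[C]_2).

Lemma eigen_adj2 X (v : 'cV[C]_2) (k : C) : v != 0 -> \det X = 1 ->
  X *m v = k *: v -> k != 0 /\ adj2 X *m v = k^-1 *: v.
Proof.
move=> v0 dX Xv; have e : adj2 X *m (X *m v) = v.
  by rewrite mulmxA mulmxE adj2_mul dX mul1mx.
rewrite Xv -scalemxAr in e.
have k0 : k != 0 by apply: contra_neq v0 => k0; rewrite -e k0 scale0r.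
by split=> //; rewrite -{2}e scalerA mulVf // scale1r.
Qed.

Lemma reducible_fricke A B : \det A = 1 -> \det B = 1 -> reducible A B ->
  fricke (\tr A) (\tr B) (\tr (A / B)) = 0.
Proof.
move=> dA dB [v [v0 [a [b [Av Bv]]]]].
have [a0 Av'] := eigen_adj2 v0 dA Av; have [b0 Bv'] := eigen_adj2 v0 dB Bv.
set K := A * adj2 B * adj2 A * B.
have Kv : (K - 1) *m v = 0.
  rewrite mulmxBl mul1mx /K -!mulmxE -!mulmxA Bv -!scalemxAr Av' -!scalemxAr Bv'.
  rewrite -!scalemxAr Av !scalerA; set k := _ * _.
  have -> : k = 1 by rewrite /k; field; rewrite a0 b0.
  by rewrite scale1r subrr.
have dK1 : \det (K - 1) = 0.
  rewrite -det_tr; apply/eqP/det0P; exists v^T; first by rewrite trmx_eq0.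
  by rewrite -trmx_mul Kv trmx0.
have dK : \det K = 1 by rewrite /K !detM !det_adj2 dA dB !mulr1.
move: dK1; rewrite det_subr1 dK trace_commutator_fricke // invmx_det1 //.
by move=> /eqP; rewrite -subr_eq0 => /eqP <-; ring.
Qed.

End ReducibleFricke.

Section Characters.
Variables (C : numClosedFieldType) (m n : int).
Implicit Types (x y z : C) (A B : 'M[C]_2).

Lemma exists_sl2_pair x y z :
  exists A B, [/\ \det A = 1, \det B = 1 & charpt A B = (x, y, z)].
Proof.
have [p hp] := exists_quadratic_root (x + y) (x * y - z + 2).
exists (mx2 x 1 (-1) 0), (mx2 p 1 (p * (y - p) - 1) (y - p)).
have dB : \det (mx2 p 1 (p * (y - p) - 1) (y - p)) = 1 by rewrite mx2_det; ring.
split=> //; first by rewrite mx2_det; ring.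
rewrite /charpt invmx_det1 //; do 3 mx2_simpl; congr (_, _, _); try ring.
by apply: (eq_by_multiple (k := 1) hp); ring.
Qed.

Lemma red_chars_fricke x y z : red_chars m n (x, y, z) -> fricke x y z = 0.
Proof.
case=> A [B [[dA [dB _]] [redAB]]]; rewrite /charpt => -[<- <- <-].
exact: reducible_fricke.
Qed.

Lemma diagonal_red_chars (s r : C) : s != 0 -> r != 0 ->
  red_chars m n (s + s^-1, r + r^-1, s / r + r / s).
Proof.
move=> s0 r0; set A := mx2 s 0 0 s^-1; set B := mx2 r 0 0 r^-1.
have dA : \det A = 1 by rewrite mx2_det mulr0 subr0 mulfV.
have dB : \det B = 1 by rewrite mx2_det mulr0 subr0 mulfV.
exists A, B; split.
  by apply/is_rep_iff => //; right; do 2 mx2_simpl; apply: mx2_congr; ring.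
split.
  exists (cv2 1 0); split; first by apply: cv2_neq0; rewrite oner_eq0.
  by exists s, r; rewrite !mx2_mulcv !cv2Z; split; congr cv2; ring.
rewrite /charpt invmx_det1 //; do 3 mx2_simpl.
by congr (_, _, _); field; rewrite s0 r0.
Qed.

Lemma fricke_red_chars x y z : fricke x y z = 0 -> red_chars m n (x, y, z).
Proof.
move=> fr0.
have inv_sum u : exists2 s : C, s != 0 & u = s + s^-1.
  have [s hs] := exists_quadratic_root u 1.
  have s0 : s != 0.
    apply/eqP => s_0; move: hs; rewrite s_0 expr0n mulr0 subrr add0r.
    by move/eqP; rewrite oner_eq0.
  exists s => //; apply: (mulIf s0); rewrite mulrDl mulVf //.
  by apply: (eq_by_multiple (k := -1) hs); ring.
have [[s s0 ex] [r r0 ey]] := (inv_sum x, inv_sum y); subst x y.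
have : (z - (s / r + r / s)) * (z - (s * r + (s * r)^-1)) = 0.
  by apply: (eq_by_multiple (k := -1) fr0); rewrite /fricke; field; rewrite s0 r0.
move/eqP; rewrite mulf_eq0 !subr_eq0 => /orP[]/eqP->; first exact: diagonal_red_chars.
have -> : (s + s^-1, r + r^-1, s * r + (s * r)^-1) =
          (s + s^-1, r^-1 + r^-1^-1, s / r^-1 + r^-1 / s).
  by congr (_, _, _); [rewrite invrK addrC | field; rewrite s0 r0].
by apply: diagonal_red_chars; rewrite ?invr_eq0.
Qed.

Lemma irr_chars_Pirr A B : is_rep m n A B -> ~ reducible A B ->
  Pirr m n (\tr A) (\tr B) (\tr (A / B)) = 0.
Proof.
move=> rep irr; have [dA [dB _]] := rep.
by case/(is_rep_iff m n dA dB): rep => // /commute_reducible.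
Qed.

Lemma Pirr_irr_chars x y z : Pirr m n x y z = 0 -> fricke x y z != 0 ->
  irr_chars m n (x, y, z).
Proof.
move=> P0 fr0; have [A [B [dA dB chAB]]] := exists_sl2_pair x y z.
exists A, B; move: (chAB); rewrite /charpt => -[ex ey ez]; split.
  by apply/(is_rep_iff m n dA dB); left; rewrite ex ey ez.
by split=> // /(reducible_fricke dA dB); rewrite ex ey ez; apply/eqP.
Qed.

End Characters.

Definition ix : 'I_3 := ord0.
Definition iy : 'I_3 := Ordinal (isT : (1 < 3)%N).
Definition iz : 'I_3 := Ordinal (isT : (2 < 3)%N).

Lemma prod_ord3 (R : comNzRingType) (F : 'I_3 -> R) : \prod_i F i = F ix * F iy * F iz.
Proof.
rewrite !big_ord_recl big_ord0 mulr1 mulrA.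
by congr (_ * F _ * F _); apply: val_inj.
Qed.

Lemma mdeg3 (e : 'X_{1..3}) : mdeg e = (e ix + e iy + e iz)%N.
Proof.
rewrite mdegE !big_ord_recl big_ord0 addn0 addnA.
by congr (_ + e _ + e _)%N; apply: val_inj.
Qed.

Lemma meval_Pirr (C : comNzRingType) (m n : int) (p : C * C * C) :
  (Pirr m n ('X_ix : {mpoly C[3]}) 'X_iy 'X_iz).@[pt3 p] = Pirr m n p.1.1 p.1.2 p.2.
Proof. by rewrite (Pirr_rmorph (meval (pt3 p))); congr Pirr; apply: mevalXU. Qed.

Section RationalCurves.
Variable C : numClosedFieldType.
Implicit Types (X Y Z h : {poly C}) (f : {mpoly C[3]}).

Lemma poly_eq0_of_roots (q : {poly C}) : (forall u, root q u) -> q = 0.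
Proof.
move=> qroot; apply: (@roots_geq_poly_eq0 _ q [seq i%:R | i <- iota 0 (size q)]).
- by apply/allP => u _; apply: qroot.
- by rewrite map_inj_uniq ?iota_uniq // => i j /eqP; rewrite eqr_nat => /eqP.
- by rewrite size_map size_iota.
Qed.

Definition curve_pt X Y Z (u : C) : C * C * C := (X.[u] / u, Y.[u] / u, Z.[u] / u).

Lemma meval_curve_pt f X Y Z :
  exists N (g : {poly C}), forall u, u != 0 -> g.[u] = u ^+ N * f.@[pt3 (curve_pt X Y Z u)].
Proof.
elim/mpolyind: f => [|c e p _ _ [N [g Hg]]].
  by exists 0%N, 0 => u _; rewrite horner0 meval0 mulr0.
exists (N + mdeg e)%N, (c *: (X ^+ e ix * Y ^+ e iy * Z ^+ e iz) * 'X^N + g * 'X^(mdeg e)).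
move=> u u0; rewrite hornerD !hornerM hornerZ !hornerM !hornerXn !horner_exp Hg //.
rewrite mevalD mevalZ mevalX prod_ord3 /pt3 /curve_pt /= mdeg3 !expr_div_n !exprD.
by field; rewrite !expf_neq0.
Qed.

Lemma meval_curve_pt_eq0 f X Y Z h (w : C) : h != 0 -> w != 0 ->
  (forall u, u != 0 -> ~~ root h u -> f.@[pt3 (curve_pt X Y Z u)] = 0) ->
  f.@[pt3 (curve_pt X Y Z w)] = 0.
Proof.
move=> h0 w0 fcurve; have [N [g Hg]] := meval_curve_pt f X Y Z.
have : 'X * h * g = 0.
  apply: poly_eq0_of_roots => u; rewrite !rootM rootX.
  have [->|u0] := eqVneq u 0; first by [].
  have [//|hu] /= := boolP (root h u).
  by apply/rootP; rewrite Hg // fcurve // mulr0.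
move/eqP; rewrite !mulf_eq0 polyX_eq0 (negbTE h0) /= => /eqP g0.
move: (Hg w w0); rewrite g0 horner0 => /esym/eqP.
by rewrite mulf_eq0 expf_eq0 (negbTE w0) andbF => /eqP.
Qed.

End RationalCurves.

Lemma poly_neq0_coef (R : nzRingType) (p : {poly R}) i : p`_i != 0 -> p != 0.
Proof. by apply: contraNneq => ->; rewrite coef0. Qed.

Section ZeroSetOfPirr.
Variables (C : numClosedFieldType) (m n : int).
Implicit Types (x y z : C).

Definition tquad z x y :=
  (x * cheb m z - y * cheb (m - 1) z) * (y * cheb m z - x * cheb (m - 1) z).

Lemma Pirr_tquad x y x' y' z : tquad z x y = tquad z x' y' ->
  Pirr m n x y z = Pirr m n x' y' z.
Proof. by rewrite /Pirr /tvar /tquad => ->. Qed.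

Lemma X_irr_line x0 y0 z0 d1 d2 : Pirr m n x0 y0 z0 = 0 ->
  z0 * d1 * d2 - d1 ^+ 2 - d2 ^+ 2 != 0 ->
  (forall w, tquad z0 (x0 + d1 * w) (y0 + d2 * w) = tquad z0 x0 y0) ->
  X_irr m n (x0, y0, z0).
Proof.
move=> P0 lead0 tq f firr.
pose X : {poly C} := 'X * (x0%:P + d1 *: ('X - 1)).
pose Y : {poly C} := 'X * (y0%:P + d2 *: ('X - 1)).
pose Z : {poly C} := z0 *: 'X.
pose B := z0 * (x0 * d2 + y0 * d1) - 2 * x0 * d1 - 2 * y0 * d2.
pose h := (z0 * d1 * d2 - d1 ^+ 2 - d2 ^+ 2) *: ('X - 1) ^+ 2 + B *: ('X - 1)
          + (fricke x0 y0 z0)%:P.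
have ptE u : u != 0 -> curve_pt X Y Z u = (x0 + d1 * (u - 1), y0 + d2 * (u - 1), z0).
  move=> u0; rewrite /curve_pt !(hornerM, hornerD, hornerZ, hornerN, hornerX, hornerC).
  by congr (_, _, _); field.
have h0 : h != 0.
  apply: (@poly_neq0_coef _ _ 2); rewrite /h sqrrB expr1n !coefE /=.
  by apply: contra_neq lead0 => <-; ring.
suff : f.@[pt3 (curve_pt X Y Z 1)] = 0 by rewrite ptE ?oner_neq0 // subrr !mulr0 !addr0.
apply: (meval_curve_pt_eq0 h0 (oner_neq0 _)) => u u0 hu; rewrite ptE //.
apply: firr; apply: Pirr_irr_chars; first by rewrite -P0; apply: Pirr_tquad.
apply: contra hu => /eqP fr; apply/rootP; rewrite -fr /h /B /fricke.
by rewrite !(hornerD, hornerZ, horner_exp, hornerN, hornerX, hornerC); ring.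
Qed.

Lemma X_irr_hyperbola x0 y0 z0 : Pirr m n x0 y0 z0 = 0 ->
  cheb m z0 ^+ 2 - cheb (m - 1) z0 ^+ 2 != 0 ->
  x0 * cheb m z0 - y0 * cheb (m - 1) z0 != 0 ->
  X_irr m n (x0, y0, z0).
Proof.
have cas := cheb_cassini m z0; rewrite -/(tquad z0 x0 y0).
set S := cheb m z0 in cas *; set a := cheb (m - 1) z0 in cas *.
set D := S ^+ 2 - a ^+ 2; set l1 := x0 * S - y0 * a; set l2 := y0 * S - x0 * a.
move=> P0 D0 l10 f firr.
(* Moving (l1, l2) to (l1 u, l2 / u) keeps the product [tquad] fixed. *)
pose X : {poly C} := (S * l1 / D) *: 'X ^+ 2 + (a * l2 / D)%:P.
pose Y : {poly C} := (a * l1 / D) *: 'X ^+ 2 + (S * l2 / D)%:P.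
pose Z : {poly C} := z0 *: 'X.
pose k := 4 * S * a - z0 * (S ^+ 2 + a ^+ 2).
pose e := S ^+ 2 - z0 * S * a + a ^+ 2.
pose h := (- (e * l1 ^+ 2) / D ^+ 2) *: 'X ^+ 4
          + ((4 - z0 ^+ 2) - k * l1 * l2 / D ^+ 2) *: 'X ^+ 2
          + (- (e * l2 ^+ 2) / D ^+ 2)%:P.
have ptE u : u != 0 -> curve_pt X Y Z u =
    ((S * l1 / D * u ^+ 2 + a * l2 / D) / u, (a * l1 / D * u ^+ 2 + S * l2 / D) / u, z0).
  move=> u0; rewrite /curve_pt !(hornerD, hornerZ, horner_exp, hornerX, hornerC).
  by congr (_, _, _); field.
have h0 : h != 0.
  apply: (@poly_neq0_coef _ _ 4); rewrite /h !coefE /= mulr1 !mulr0 !addr0 /e cas.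
  by rewrite mul1r mulNr oppr_eq0 mulf_eq0 invr_eq0 !expf_eq0 /= (negbTE l10) (negbTE D0).
have -> : (x0, y0, z0) = curve_pt X Y Z 1.
  by rewrite ptE ?oner_neq0 // /l1 /l2 /D; congr (_, _, _); field.
apply: (meval_curve_pt_eq0 h0 (oner_neq0 _)) => u u0 hu; rewrite ptE //.
apply: firr; apply: Pirr_irr_chars.
  rewrite -P0; apply: Pirr_tquad; rewrite /tquad -/S -/a /l1 /l2 /D.
  by field; rewrite u0 D0.
apply: contra hu => /eqP fr; apply/rootP; rewrite -[RHS](mulr0 (u ^+ 2)) -fr /h /fricke /k.
rewrite !(hornerD, hornerZ, horner_exp, hornerX, hornerC) /e /l1 /l2 /D.
by field; rewrite u0 D0.
Qed.

Lemma X_irr_degenerate x y z e : e ^+ 2 = 1 -> cheb (m - 1) z = e * cheb m z ->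
  Pirr m n x y z = 0 -> X_irr m n (x, y, z).
Proof.
move=> e2 aS P0; have cas := cheb_cassini m z; rewrite aS in cas.
apply: (X_irr_line (d1 := 1) (d2 := e) P0); last first.
  by move=> w; rewrite /tquad aS; ring: e2.
apply/eqP => lead0; suff : (1 : C) = 0 by move/eqP; rewrite oner_eq0.
by rewrite -cas; apply: (eq_by_multiple (k := - cheb m z ^+ 2) lead0); ring: e2.
Qed.

Lemma X_irr_of_Pirr x y z : Pirr m n x y z = 0 -> X_irr m n (x, y, z).
Proof.
move=> P0; have cas := cheb_cassini m z.
set S := cheb m z in cas; set a := cheb (m - 1) z in cas.
have [l0|l0] := eqVneq (x * S - y * a) 0.
  apply: (X_irr_line (d1 := a) (d2 := S) P0).
    by rewrite (_ : _ - _ = -1) ?oppr_eq0 ?oner_eq0 // -cas; ring.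
  move=> w; rewrite /tquad -/S -/a.
  have -> : (x + a * w) * S - (y + S * w) * a = x * S - y * a by ring.
  by rewrite l0 !mul0r.
have [D0|D0] := eqVneq (S ^+ 2 - a ^+ 2) 0; last exact: X_irr_hyperbola.
have : (a - S) * (a + S) = 0 by rewrite -[RHS]oppr0 -D0; ring.
move/eqP; rewrite mulf_eq0 => /orP[] /eqP aS.
  by apply: (X_irr_degenerate (e := 1)) P0; rewrite ?expr1n // mul1r; exact: subr0_eq.
apply: (X_irr_degenerate (e := -1)) P0; first by rewrite sqrrN expr1n.
by rewrite mulN1r; apply/eqP; rewrite -addr_eq0 aS.
Qed.

End ZeroSetOfPirr.

Theorem theorem1p1 (C : numClosedFieldType) (m n : int) (hm : m != 0) :
  (forall x y z : C,
      x * y * z + 4 - x ^+ 2 - y ^+ 2 - z ^+ 2 = 0 <-> red_chars m n (x, y, z))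
  /\
  (forall x y z : C, X_irr m n (x, y, z) <-> Pirr m n x y z = 0).
Proof.
(* The argument is uniform in [m]. *)
split=> x y z; first by split; [exact: fricke_red_chars | exact: red_chars_fricke].
split; last exact: X_irr_of_Pirr.
move/(_ (Pirr m n ('X_ix : {mpoly C[3]}) 'X_iy 'X_iz)); rewrite meval_Pirr; apply.
case=> [[x' y'] z'] [A [B [rep [irr]]]]; rewrite /charpt meval_Pirr => -[<- <- <-].
exact: irr_chars_Pirr.
Qed.
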